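(* Let $p\ge1$, $n\ge0$ be integers, $\mathbf{x}=(x_1,\dots,x_{p-1})\in\mathbb{C}^{p-1}$, $\mathbf{y}=(y_1,\dots,y_p)\in\mathbb{C}^{p}$, and $\nu=\nu(\mathbf{x};\mathbf{y})=\sum_{j=1}^{p}y_j-\sum_{j=1}^{p-1}x_j$. Then for arbitrary $\alpha\in\mathbb{C}$ the N{\o}rlund coefficient $g_n^p(\mathbf{x};\mathbf{y})$ satisfies $$g_n^{p}(\mathbf{x};\mathbf{y})=\sum_{r=0}^n\frac{(1+\alpha-\nu-n)_{n-r}}{r!\,(n-r)!}\,Y_r(\hat{q}_1,\hat{q}_2,\dots,\hat{q}_r)\,\mathcal{B}^{(n+\nu-\alpha)}_{n-r}(1-\alpha),$$ where $$\hat{q}_m=\frac{(-1)^{m+1}(m-1)!}{m+1}\Bigg(\mathcal{B}_{m+1}(\alpha)+\sum_{j=1}^{p-1}\mathcal{B}_{m+1}(x_j)-\sum_{j=1}^{p}\mathcal{B}_{m+1}(y_j)\Bigg).$$ In particular, for $p\ge3$ the terminating multiple hypergeometric series $A_n^p(\mathbf{x};\mathbf{y})$ and $B_n^p(\mathbf{x};\mathbf{y})$ defined in the context are both equal to the right-hand side of this formula.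
   Context: $(c)_k=c(c+1)\cdots(c+k-1)$, $(c)_0=1$. The N{\o}rlund coefficients $g_n^p(\mathbf{x};\mathbf{y})$ are the polynomials determined by $g_0^1(-;y_1)=1$, $g_n^1(-;y_1)=0$ for $n\ge1$, and for $p\ge2$ $$g_n^{p}(\mathbf{x};\mathbf{y})=\sum_{m=0}^{n}\frac{(y_{p}-x_{p-1})_{n-m}}{(n-m)!}(\nu_{p-1}+m)_{n-m}\,g_m^{p-1}\big((x_1,\dots,x_{p-2});(y_1,\dots,y_{p-1})\big),$$ where $\nu_m=\sum_{k=1}^{m}(y_k-x_k)$. The Bernoulli--N{\o}rlund (generalized Bernoulli) polynomials $\mathcal{B}^{(\sigma)}_k(z)$, $\sigma\in\mathbb{C}$, are defined by $\left(\frac{t}{e^t-1}\right)^{\sigma}e^{zt}=\sum_{k\ge0}\mathcal{B}^{(\sigma)}_k(z)\frac{t^k}{k!}$ (the power being equal to $1$ at $t=0$), and $\mathcal{B}_k(z)=\mathcal{B}^{(1)}_k(z)$ are the classical Bernoulli polynomials. The complete exponential Bell polynomials $Y_r$ are defined by $\exp\big(\sum_{m\ge1}z_m\frac{t^m}{m!}\big)=1+\sum_{r\ge1}Y_r(z_1,\dots,z_r)\frac{t^r}{r!}$, with $Y_0=1$. Series $A_n^p$, $B_n^p$ ($p\ge3$): set $\psi_m=\sum_{j=1}^m y_j-\sum_{j=1}^{m-1}x_j$. For $\mathbf{l}_{p-2}=(l_1,\dots,l_{p-2})\in\mathbb{N}_0^{p-2}$ put $l_{p-1}=n-l_1-\cdots-l_{p-2}$,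 $|\mathbf{l}_0|=0$, $|\mathbf{l}_s|=l_1+\cdots+l_s$. Then $$A_n^p=\frac{(\nu_{p-1})_{n}(y_{p}-x_{p-1})_{n}}{n!}\sum_{\mathbf{l}_{p-2}\in\mathbb{N}_0^{p-2}}\frac{(-n)_{|\mathbf{l}_{p-2}|}}{(1-y_{p}+x_{p-1}-n)_{|\mathbf{l}_{p-2}|}}\prod_{s=1}^{p-2}\frac{(\nu_{s})_{|\mathbf{l}_{s}|}(y_{s+1}-x_s)_{l_{s}}}{(\nu_{s+1})_{|\mathbf{l}_{s}|}\,l_s!}.$$ For odd $p\ge3$, $$B_n^p=\sum_{\mathbf{l}_{p-2}\in\mathbb{N}_0^{p-2}}\frac{(-n)_{|\mathbf{l}_{p-2}|}(-1)^{l_2+l_4+\cdots+l_{p-3}}}{l_{1}!\cdots l_{p-2}!\,n!}\prod_{\substack{2\le m\le p-1\\ m\text{ even}}}\frac{(\psi_{m-1}-x_{m-1})_{|\mathbf{l}_{m-1}|}(\psi_{m-1}-x_{m})_{|\mathbf{l}_{m-1}|}(\psi_{m+1}-y_{m})_{|\mathbf{l}_{m}|}(\psi_{m+1}-y_{m+1})_{|\mathbf{l}_{m}|}}{(\psi_{m-1}-x_{m-1})_{|\mathbf{l}_{m-2}|}(\psi_{m-1}-x_{m})_{|\mathbf{l}_{m-2}|}(\psi_{m+1}-y_{m})_{|\mathbf{l}_{m-1}|}(\psi_{m+1}-y_{m+1})_{|\mathbf{l}_{m-1}|}}$$ (sign exponent $0$ for $p=3$), and for even $p\ge4$, $$B_n^p=\sum_{\mathbf{l}_{p-2}\in\mathbb{N}_0^{p-2}}\frac{(-n)_{|\mathbf{l}_{p-2}|}(-1)^{l_1+l_3+\cdots+l_{p-3}}}{l_{1}!\cdots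 l_{p-2}!\,n!}(\psi_2-y_2)_{l_1}(\psi_2-y_1)_{l_1}\prod_{\substack{2\le m\le p-2\\ m\text{ even}}}\frac{(\psi_{m}-x_{m})_{|\mathbf{l}_{m}|}(\psi_{m}-x_{m+1})_{|\mathbf{l}_{m}|}(\psi_{m+2}-y_{m+1})_{|\mathbf{l}_{m+1}|}(\psi_{m+2}-y_{m+2})_{|\mathbf{l}_{m+1}|}}{(\psi_{m}-x_{m})_{|\mathbf{l}_{m-1}|}(\psi_{m}-x_{m+1})_{|\mathbf{l}_{m-1}|}(\psi_{m+2}-y_{m+1})_{|\mathbf{l}_{m}|}(\psi_{m+2}-y_{m+2})_{|\mathbf{l}_{m}|}}.$$ Both are polynomials in $(\mathbf{x},\mathbf{y})$: ratios of Pochhammer symbols with the same base are read as $(c)_K/(c)_L=(c+L)_{K-L}$ for $K\ge L$ (in $A_n^p$ the factors in $\nu_s$ telescope this way, including the prefactor $(\nu_{p-1})_n$), and $(c)_n/(1-c-n)_L=(-1)^L(c)_{n-L}$. *)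

(* Defs.v *)
From HB Require Import structures.
From mathcomp Require Import all_boot all_order all_algebra.
From mathcomp Require Import ring.

Set Implicit Arguments.
Unset Strict Implicit.
Unset Printing Implicit Defensive.

Import Order.TTheory GRing.Theory Num.Theory.
Local Open Scope ring_scope.

(* Families x, y are 1-indexed: x k is x_k, for k >= 1.  [entry s] is the
   1-indexed family of the entries of s. *)
Definition entry (C : nmodType) (s : seq C) (k : nat) : C := s`_k.-1.

Section Pochhammer.
Variable C : numFieldType.
Implicit Types (c : C) (k n K L : nat).

Definition poch c k : C := \prod_(i < k) (c + i%:R).

(* (c)_K / (c)_L for L <= K, read as the polynomial (c + L)_(K - L). *)
Definition poch_ratio c K L : C := poch (c + L%:R) (K - L).

(* (c)_n / (1 - c - n)_L for L <= n, read as (-1)^L (c)_(n - L). *)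
Definition poch_refl_ratio c n L : C := (-1) ^+ L * poch c (n - L).

Lemma poch_cat c k m : poch c (k + m) = poch c k * poch (c + k%:R) m.
Proof.
rewrite /poch big_split_ord /=; congr (_ * _).
by apply: eq_bigr => i _; rewrite natrD addrA.
Qed.

Lemma poch_ratioE c K L :
  (L <= K)%N -> poch c L != 0 -> poch c K / poch c L = poch_ratio c K L.
Proof.
by move=> leLK c0; rewrite -{1}(subnKC leLK) poch_cat mulrAC divff // mul1r.
Qed.

Lemma poch_refl c m : poch (1 - c - m%:R) m = (-1) ^+ m * poch c m.
Proof.
rewrite /poch (reindex_inj rev_ord_inj) /= -[X in (-1) ^+ X]card_ord -prodrN.
by apply: eq_bigr => i _; rewrite natrB ?ltn_ord // -natr1; ring.
Qed.

Lemma poch_refl_ratioE c n L :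
  (L <= n)%N -> poch (1 - c - n%:R) L != 0 ->
  poch c n / poch (1 - c - n%:R) L = poch_refl_ratio c n L.
Proof.
move=> leLn nz; have E : poch (1 - c - n%:R) L =
    (-1) ^+ L * poch (c + (n - L)%:R) L.
  by rewrite -poch_refl natrB //; congr (poch _ _); ring.
have nz' : poch (c + (n - L)%:R) L != 0.
  by apply: contra_neq nz => h; rewrite E h mulr0.
rewrite /poch_refl_ratio E -{1}(subnK leLn) poch_cat invfM invr_sign.
by rewrite mulrCA mulfK.
Qed.

Lemma poch_oppn_eq0 n k : (n < k)%N -> poch (- n%:R) k = 0.
Proof.
by move=> lt; rewrite /poch (bigD1 (Ordinal lt)) //= addNr mul0r.
Qed.

End Pochhammer.

(* Formal power series, as coefficient sequences. *)
Section FormalSeries.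
Variable C : numFieldType.
Implicit Types (f g : nat -> C) (s z : C).

Definition fps_mul f g (n : nat) : C := \sum_(i < n.+1) f i * g (n - i)%N.

Definition fps_one (n : nat) : C := (n == 0%N)%:R.

Definition fps_pow f (k : nat) : nat -> C := iter k (fps_mul f) fps_one.

(* In the next three definitions the sum over k is an infinite sum of series of
   which only the terms k <= n contribute to the coefficient of t^n, since the
   k-th power of a series without constant term starts at t^k. *)

(* exp f, for f 0 = 0. *)
Definition fps_exp f (n : nat) : C :=
  \sum_(k < n.+1) fps_pow f k n / (k`!)%:R.

(* 1 / f, for f 0 = 1: the geometric series in 1 - f. *)
Definition fps_inv f (n : nat) : C :=
  \sum_(k < n.+1) fps_pow (fun i => fps_one i - f i) k n.

Definition gbinom s (k : nat) : C := (\prod_(i < k) (s - i%:R)) / (k`!)%:R.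

(* f ^ s for f 0 = 1, with constant term 1: the binomial series in f - 1. *)
Definition fps_cpow f s (n : nat) : C :=
  \sum_(k < n.+1) gbinom s k * fps_pow (fun i => f i - fps_one i) k n.

(* t / (e^t - 1) is the inverse of (e^t - 1) / t = \sum_k t^k / (k + 1)!. *)
Definition todd : nat -> C := fps_inv (fun k => ((k.+1)`!)%:R^-1).

Definition exp_series z (k : nat) : C := z ^+ k / (k`!)%:R.

(* gen_bernoulli s k z is B^(s)_k(z). *)
Definition gen_bernoulli s (k : nat) z : C :=
  (k`!)%:R * fps_mul (fps_cpow todd s) (exp_series z) k.

Definition bernoulli (k : nat) z : C := gen_bernoulli 1 k z.

(* Y_r(z_1, ..., z_r); only the values z 1, ..., z r matter. *)
Definition bell (r : nat) (z : nat -> C) : C :=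
  (r`!)%:R * fps_exp (fun m => if m == 0%N then 0 else z m / (m`!)%:R) r.

End FormalSeries.

Section Norlund.
Variable C : numFieldType.
Implicit Types (x y : nat -> C) (p n m : nat) (l : seq nat).

Definition nu x y m : C := \sum_(1 <= k < m.+1) (y k - x k).

Definition psi x y m : C := \sum_(1 <= j < m.+1) y j - \sum_(1 <= j < m) x j.

(* g_n^p, for p >= 1 (the value at p = 0 is irrelevant); q below is p - 1. *)
Fixpoint norlund p n x y : C :=
  match p with
  | 0 => 0
  | 1 => (n == 0%N)%:R
  | (_.+1 as q).+1 =>
      \sum_(m < n.+1)
        poch (y q.+1 - x q) (n - m) / ((n - m)`!)%:R
        * poch (nu x y q + m%:R) (n - m) * norlund q m x y
  end.

(* The entries l_1, ..., l_(p-2) of l are followed by l_(p-1) = n - |l|; then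
   idx n l s is l_s and partial n l s is |l_s|, for s <= p - 1.  When |l| > n
   the subtraction truncates, but the factor (-n)_|l| vanishes. *)
Definition full_index n l : seq nat := rcons l (n - sumn l)%N.
Definition idx n l s : nat := nth 0%N (full_index n l) s.-1.
Definition partial n l s : nat := sumn (take s (full_index n l)).

Definition A_term p n x y l : C :=
  (n`!)%:R^-1 * poch (- n%:R) (sumn l)
  * poch_refl_ratio (y p - x p.-1) n (sumn l)
  (* (nu_(p-1))_n prod_s (nu_s)_|l_s| / (nu_(s+1))_|l_s|, telescoped *)
  * (poch_ratio (nu x y p.-1) n (sumn l)
     * \prod_(1 <= s < p.-1)
         poch_ratio (nu x y s) (partial n l s) (partial n l s.-1))
  * \prod_(1 <= s < p.-1)
      (poch (y s.+1 - x s) (idx n l s) / ((idx n l s)`!)%:R).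

Definition B_odd_term p n x y l : C :=
  poch (- n%:R) (sumn l)
  * (-1) ^+ (\sum_(1 <= i < p.-2 | ~~ odd i) idx n l i)%N
  / ((\prod_(1 <= s < p.-1) (idx n l s)`!)%N%:R * (n`!)%:R)
  * \prod_(2 <= m < p | ~~ odd m)
      (poch_ratio (psi x y m.-1 - x m.-1) (partial n l m.-1) (partial n l m.-2)
       * poch_ratio (psi x y m.-1 - x m) (partial n l m.-1) (partial n l m.-2)
       * poch_ratio (psi x y m.+1 - y m) (partial n l m) (partial n l m.-1)
       * poch_ratio (psi x y m.+1 - y m.+1) (partial n l m)
           (partial n l m.-1)).

Definition B_even_term p n x y l : C :=
  poch (- n%:R) (sumn l)
  * (-1) ^+ (\sum_(1 <= i < p.-2 | odd i) idx n l i)%N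
  / ((\prod_(1 <= s < p.-1) (idx n l s)`!)%N%:R * (n`!)%:R)
  * (poch (psi x y 2 - y 2%N) (idx n l 1) * poch (psi x y 2 - y 1%N) (idx n l 1))
  * \prod_(2 <= m < p.-1 | ~~ odd m)
      (poch_ratio (psi x y m - x m) (partial n l m) (partial n l m.-1)
       * poch_ratio (psi x y m - x m.+1) (partial n l m) (partial n l m.-1)
       * poch_ratio (psi x y m.+2 - y m.+1) (partial n l m.+1) (partial n l m)
       * poch_ratio (psi x y m.+2 - y m.+2) (partial n l m.+1)
           (partial n l m)).

Definition B_term p n x y l : C :=
  if odd p then B_odd_term p n x y l else B_even_term p n x y l.

(* By the next two lemmas the series terminate: only the multi-indices with
   |l| <= n contribute, all of which have entries at most n. *)
Lemma A_term_eq0 p n x y l : (n < sumn l)%N -> A_term p n x y l = 0.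
Proof.
by move=> lt; rewrite /A_term (poch_oppn_eq0 _ lt) mulr0 !mul0r.
Qed.

Lemma B_term_eq0 p n x y l : (n < sumn l)%N -> B_term p n x y l = 0.
Proof.
move=> lt; rewrite /B_term /B_odd_term /B_even_term (poch_oppn_eq0 _ lt).
by case: ifP; rewrite !mul0r.
Qed.

(* A_n^p and B_n^p, for p >= 3. *)
Definition A_series p n x y : C :=
  \sum_(l : p.-2.-tuple 'I_n.+1) A_term p n x y (map val l).

Definition B_series p n x y : C :=
  \sum_(l : p.-2.-tuple 'I_n.+1) B_term p n x y (map val l).

End Norlund.

(* Main.v *)
(* The coefficients g_n^p are those of the inverse factorial expansion
     prod_j Gamma(s + x_j) / prod_j Gamma(s + y_j)
       = sum_n g_n^p / Gamma(s + nu + n),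
   and multiplying by Gamma(s + alpha) and comparing with the Stirling series of
   log Gamma gives the formula.  This can be made algebraic.  By induction on p,
   both sides are polynomials in the last x, they agree when it equals the last
   y, and they satisfy the same recurrence under x -> x + 1 (which is
   Gamma(s + x + 1) = (s + x) Gamma(s + x)); for p = 1 the same argument is run
   in alpha.  On the right-hand side the recurrence comes from
   B_k(z + 1) - B_k(z) = k z^(k - 1) and from the contiguity relations of the
   Bernoulli-Norlund polynomials.

   A_n^p is the p-fold unfolding of the recursion that defines g_n^p.  B_n^p is
   the unfolding of a recursion from p to p + 2, obtained by transforming a
   terminating 3F2 with two Chu-Vandermonde sums. *)
From HB Require Import structures.
Require Import Defs.
From mathcomp Require Import all_boot all_order all_algebra.
From mathcomp Require Import boolp reals complex ring.
Import GRing.Theory Num.Theory.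
Local Open Scope ring_scope.

Set Implicit Arguments.
Unset Strict Implicit.
Unset Printing Implicit Defensive.

(** * Formal power series *)

(** The synonym carries the ring structure given by the Cauchy product, which makes [ring] available
    for series. *)
Definition fps (C : numFieldType) := nat -> C.

Section FpsRing.
Variable C : numFieldType.
Implicit Types (f g h : fps C) (a s z : C).

Definition fps_add f g : fps C := fun n => f n + g n.
Definition fps_opp f : fps C := fun n => - f n.

HB.instance Definition _ := Choice.copy (fps C) (nat -> C).

Let addA : associative fps_add.
Proof. by move=> f g h; apply/funext => n; rewrite /fps_add addrA. Qed.
Let addC : commutative fps_add.
Proof. by move=> f g; apply/funext => n; rewrite /fps_add addrC. Qed.
Let add0 : left_id (fun=> 0) fps_add.
Proof. by move=> f; apply/funext => n; rewrite /fps_add add0r. Qed.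
Let addN : left_inverse (fun=> 0) fps_opp fps_add.
Proof. by move=> f; apply/funext => n; rewrite /fps_add addNr. Qed.

HB.instance Definition _ := GRing.isZmodule.Build (fps C) addA addC add0 addN.

(** Low coefficients of a product only see truncations, so commutativity and associativity are
    inherited from polynomials. *)
Let fps_mul_trunc N f g i : (i < N)%N ->
  fps_mul f g i = ((\poly_(j < N) f j) * (\poly_(j < N) g j))`_i.
Proof.
move=> lti; rewrite coefM; apply: eq_bigr => j _; rewrite !coef_poly.
rewrite (leq_ltn_trans _ lti); last by rewrite -ltnS.
by rewrite (leq_ltn_trans _ lti) // leq_subr.
Qed.

Let mulC : commutative (@fps_mul C).
Proof.
by move=> f g; apply/funext => n; rewrite !(fps_mul_trunc _ _ (ltnSn n)) mulrC.
Qed.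

Let mulA : associative (@fps_mul C).
Proof.
move=> f g h; apply/funext => n.
pose tr f := \poly_(j < n.+1) f j : {poly C}.
transitivity ((tr f * (tr g * tr h))`_n).
  rewrite coefM; apply: eq_bigr => j _.
  by rewrite -fps_mul_trunc ?ltnS ?leq_subr // coef_poly ltn_ord.
rewrite mulrA coefM; apply: eq_bigr => j _; rewrite -fps_mul_trunc //.
by rewrite coef_poly ltnS leq_subr.
Qed.

Let mul1 : left_id (@fps_one C) (@fps_mul C).
Proof.
move=> f; apply/funext => n; rewrite /fps_mul big_ord_recl /= subn0 mul1r.
by rewrite big1 ?addr0 // => i _; rewrite /fps_one /= mul0r.
Qed.

Let mulDl : left_distributive (@fps_mul C) fps_add.
Proof.
move=> f g h; apply/funext => n; rewrite /fps_add /fps_mul -big_split /=.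
by apply: eq_bigr => i _; rewrite mulrDl.
Qed.

Let one_neq0 : @fps_one C != 0 :> fps C.
Proof.
by apply/eqP => /(congr1 (fun f : fps C => f 0%N)) /eqP; rewrite /= oner_eq0.
Qed.

HB.instance Definition _ := GRing.Zmodule_isComNzRing.Build (fps C)
  mulA mulC mul1 mulDl one_neq0.

Lemma fpsD f g n : (f + g) n = f n + g n. Proof. by []. Qed.
Lemma fpsN f n : (- f) n = - f n. Proof. by []. Qed.
Lemma fpsB f g n : (f - g) n = f n - g n. Proof. by []. Qed.
Lemma fps1E n : (1 : fps C) n = (n == 0%N)%:R. Proof. by []. Qed.
Lemma fpsM f g n : (f * g) n = \sum_(i < n.+1) f i * g (n - i)%N.
Proof. by []. Qed.

Lemma fpsM0 f g : (f * g) 0%N = f 0%N * g 0%N.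
Proof. by rewrite fpsM big_ord1. Qed.

Lemma fps_sumE (I : Type) (r : seq I) (P : pred I) (F : I -> fps C) n :
  (\sum_(i <- r | P i) F i) n = \sum_(i <- r | P i) F i n.
Proof. by elim/big_rec2: _ => // i a b _ <-. Qed.

Lemma fps_powE f k : fps_pow f k = f ^+ k.
Proof. by elim: k => [|k IH] //; rewrite exprS -IH. Qed.

Definition fpsC (a : C) : fps C := fun n => if n == 0%N then a else 0.
Definition fpsX : fps C := fun n => (n == 1%N)%:R.

Lemma fpsCM a f n : (fpsC a * f) n = a * f n.
Proof.
rewrite fpsM big_ord_recl /= subn0 big1 ?addr0 // => i _.
by rewrite /fpsC /= mul0r.
Qed.

Lemma fpsXM f n : (fpsX * f) n = if n is m.+1 then f m else 0.
Proof.
case: n => [|n]; rewrite fpsM big_ord_recl /= mul0r ?big_ord0 ?add0r //.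
rewrite big_ord_recl /= mul1r big1 ?addr0 // => [|i _]; last by rewrite mul0r.
by rewrite /bump /= subSS subn0.
Qed.

Lemma fpsC_is_zmod_morphism : zmod_morphism fpsC.
Proof.
move=> a b; apply/funext => n; rewrite fpsB /fpsC.
by case: eqP => //; rewrite subr0.
Qed.
HB.instance Definition _ := GRing.isZmodMorphism.Build C (fps C) fpsC
  fpsC_is_zmod_morphism.
Lemma fpsC_is_monoid_morphism : monoid_morphism fpsC.
Proof.
split; first by apply/funext => n; rewrite fps1E /fpsC; case: eqP.
move=> a b; apply/funext => n; rewrite fpsCM /fpsC.
by case: eqP; rewrite ?mulr0.
Qed.
HB.instance Definition _ := GRing.isMonoidMorphism.Build C (fps C) fpsC
  fpsC_is_monoid_morphism.

(* The Euler derivation t d/dt. *)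
Definition euler f : fps C := fun n => n%:R * f n.

Lemma euler_is_zmod_morphism : zmod_morphism euler.
Proof. by move=> f g; apply/funext => n; rewrite !fpsB /euler fpsB mulrBr. Qed.
HB.instance Definition _ := GRing.isZmodMorphism.Build (fps C) (fps C) euler
  euler_is_zmod_morphism.

Lemma eulerM f g : euler (f * g) = euler f * g + f * euler g.
Proof.
apply/funext => n; rewrite fpsD /euler !fpsM mulr_sumr -big_split /=.
apply: eq_bigr => i _.
have {1}-> : n%:R = i%:R + (n - i)%:R :> C.
  by rewrite -natrD subnKC // -ltnS.
by ring.
Qed.

Lemma eulerC a : euler (fpsC a) = 0.
Proof.
apply/funext => n; rewrite /euler /fpsC.
by case: eqP => [->|_]; rewrite ?mul0r ?mulr0.
Qed.

Lemma euler1 : euler 1 = 0.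
Proof. by rewrite -(rmorph1 fpsC) eulerC. Qed.

Lemma eulerX : euler fpsX = fpsX.
Proof.
by apply/funext => -[|[|n]]; rewrite /euler /fpsX /= ?mulr0 ?mulr1.
Qed.

Lemma euler_exp f k : euler (f ^+ k.+1) = fpsC k.+1%:R * (euler f * f ^+ k).
Proof.
elim: k => [|k IH]; first by rewrite expr1 expr0 rmorph1 mul1r mulr1.
have -> : k.+2%:R = k.+1%:R + 1 :> C by rewrite natr1.
rewrite exprS eulerM IH rmorphD rmorph1 !exprS.
by ring.
Qed.

(* Identities between power series are proved below by comparing logarithmic
   derivatives. *)
Lemma euler_ode_uniq g f h : g 0%N = 0 -> f 0%N = h 0%N ->
  euler f = g * f -> euler h = g * h -> f = h.
Proof.
move=> g0 e0 ef eh; apply/funext; elim/ltn_ind => -[//|n] IH.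
have := congr1 (fun s : fps C => s n.+1) ef.
rewrite fpsM big_ord_recl g0 mul0r add0r.
rewrite [X in _ = X](eq_bigr (fun i : 'I_n.+1 =>
  g (lift ord0 i) * h (n.+1 - lift ord0 i)%N)); last first.
  by move=> i _; rewrite IH // ltnS subSS leq_subr.
have := congr1 (fun s : fps C => s n.+1) eh.
rewrite fpsM big_ord_recl g0 mul0r add0r => <-.
by apply: mulfI; rewrite pnatr_eq0.
Qed.

Lemma fps_exp_coef_eq0 f k n : f 0%N = 0 -> (n < k)%N -> (f ^+ k) n = 0.
Proof.
move=> f0; elim: k n => // k IH n ltn; rewrite exprS fpsM big_ord_recl f0 mul0r.
rewrite add0r big1 // => i _; rewrite IH ?mulr0 //.
rewrite /= /bump add1n; case: n i ltn => [[]|n] // i ltn.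
by rewrite subSS (leq_ltn_trans (leq_subr _ _)).
Qed.

(* c is the coefficient sequence of the outer series; meaningful for f 0 = 0,
   where the terms of index k > n do not contribute to the coefficient of t^n. *)
Definition fps_subst (c : nat -> C) f : fps C :=
  fun n => \sum_(k < n.+1) c k * (f ^+ k) n.

(** Every truncation order [N >= n] gives the same coefficient, so substitution can be computed with
    finite sums in the ring of series. *)
Lemma fps_subst_trunc c f n N : f 0%N = 0 -> (n <= N)%N ->
  fps_subst c f n = (\sum_(k < N.+1) fpsC (c k) * f ^+ k) n.
Proof.
move=> f0 leN; rewrite fps_sumE /fps_subst.
rewrite (big_ord_widen N.+1 (fun k => c k * (f ^+ k) n)) // big_mkcond /=.
apply: eq_bigr => k _; rewrite fpsCM.
by case: ltnP => // ltn; rewrite fps_exp_coef_eq0 ?mulr0.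
Qed.

Lemma fps_substM c f g n : f 0%N = 0 ->
  (g * fps_subst c f) n = (g * \sum_(k < n.+1) fpsC (c k) * f ^+ k) n.
Proof.
move=> f0; apply: eq_bigr => i _.
by rewrite (fps_subst_trunc _ f0 (leq_subr i n)).
Qed.

Lemma fps_subst0 c f : fps_subst c f 0 = c 0%N.
Proof. by rewrite /fps_subst big_ord1 expr0 mulr1. Qed.

Lemma fps_substD c d f :
  fps_subst (fun k => c k + d k) f = fps_subst c f + fps_subst d f.
Proof.
apply/funext => n; rewrite fpsD /fps_subst -big_split /=.
by apply: eq_bigr => i _; rewrite mulrDl.
Qed.

Lemma fps_substZ a c f : fps_subst (fun k => a * c k) f = fpsC a * fps_subst c f.
Proof.
apply/funext => n; rewrite fpsCM /fps_subst mulr_sumr.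
by apply: eq_bigr => i _; rewrite mulrA.
Qed.

(** With [c] constantly 1 this gives inverses; with [c k = k * gbinom s k] it gives the differential
    equation of the s-th power. *)
Lemma fps_subst_shift c f : f 0%N = 0 ->
  f * fps_subst (fun k => c k.+1) f = fps_subst c f - fpsC (c 0%N).
Proof.
move=> f0; apply/funext => n; rewrite fps_substM // fpsB.
rewrite (fps_subst_trunc c f0 (leqnSn n)) [in RHS]big_ord_recl expr0 mulr1.
rewrite [fpsC _ + _]addrC fpsD addrK mulr_sumr !fps_sumE; apply: eq_bigr => k _.
by rewrite exprS mulrCA.
Qed.

(** Chain rule: the new coefficients are those of the derivative of the outer series. *)
Lemma euler_subst c f : f 0%N = 0 ->
  euler (fps_subst c f) = euler f * fps_subst (fun k => k.+1%:R * c k.+1) f.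
Proof.
move=> f0; apply/funext => n; rewrite fps_substM // {1}/euler.
rewrite (fps_subst_trunc c f0 (leqnSn n)) -/(euler _ n) raddf_sum.
rewrite [in LHS]big_ord_recl.
rewrite /= expr0 mulr1 eulerC add0r mulr_sumr.
apply: (congr1 (fun s : fps C => s n)); apply: eq_bigr => k _.
rewrite eulerM eulerC mul0r add0r euler_exp rmorphM /=; ring.
Qed.

(** * Exponential, inverse and complex powers of a series *)

Lemma fps_expE f : fps_exp f = fps_subst (fun k => (k`!)%:R^-1) f.
Proof.
by apply/funext => n; apply: eq_bigr => k _; rewrite fps_powE mulrC.
Qed.

Lemma euler_fps_exp f : f 0%N = 0 -> euler (fps_exp f) = euler f * fps_exp f.
Proof.
move=> f0; rewrite fps_expE euler_subst //; congr (_ * fps_subst _ _).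
apply/funext => k; rewrite factS natrM invfM mulrA divff ?mul1r //.
by rewrite pnatr_eq0.
Qed.

Lemma fps_exp0 f : fps_exp f 0 = 1.
Proof. by rewrite fps_expE fps_subst0 fact0 invr1. Qed.

Lemma fps_expD f g : f 0%N = 0 -> g 0%N = 0 ->
  fps_exp ((f + g : fps C)) = (fps_exp f : fps C) * fps_exp g.
Proof.
move=> f0 g0; apply: (@euler_ode_uniq (euler (f + g))).
- by rewrite /euler mul0r.
- by rewrite fps_exp0 fpsM big_ord1 !fps_exp0 mulr1.
- by rewrite euler_fps_exp // fpsD f0 g0 addr0.
by rewrite eulerM !euler_fps_exp // raddfD /=; ring.
Qed.

Lemma fps_invE f : fps_inv f = fps_subst (fun=> 1) (1 - f).
Proof.
by apply/funext => n; apply: eq_bigr => k _; rewrite fps_powE mul1r.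
Qed.

Lemma fps_mulV f : f 0%N = 1 -> f * fps_inv f = 1.
Proof.
move=> f1; have := @fps_subst_shift (fun=> 1) (1 - f).
rewrite fpsB f1 subrr -fps_invE rmorph1 => /(_ erefl) e.
set v : fps C := fps_inv f in e *.
by rewrite -[LHS](subKr v) -[X in X - f * v]mul1r -mulrBl e subKr.
Qed.

Lemma fps_cpowE f s : fps_cpow f s = fps_subst (gbinom s) (f - 1).
Proof. by apply/funext => n; apply: eq_bigr => k _; rewrite fps_powE. Qed.

Lemma fps_cpow0 f s : fps_cpow f s 0 = 1.
Proof.
by rewrite fps_cpowE fps_subst0 /gbinom big_ord0 fact0 divff ?oner_eq0.
Qed.

Lemma gbinomS s k : k.+1%:R * gbinom s k.+1 = (s - k%:R) * gbinom s k.
Proof.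
rewrite /gbinom big_ord_recr /= factS natrM invfM.
by field; rewrite ?pnatr_eq0 ?nat1r ?pnatr_eq0 -?lt0n ?fact_gt0.
Qed.

(** With w = f - 1 and b_k = [gbinom s k], multiplying the derivative series by 1 + w gives the
    coefficients (k + 1) b_(k+1) + k b_k = s b_k. The factor [f] on the left avoids a division. *)
Lemma euler_cpow f s : f 0%N = 1 ->
  f * euler (fps_cpow f s) = fpsC s * euler f * fps_cpow f s.
Proof.
move=> f1; have w0 : (f - 1) 0%N = 0 by rewrite fpsB f1 subrr.
rewrite fps_cpowE; set w := f - 1 in w0 *.
rewrite euler_subst // -/w.
have -> : euler f = euler w by rewrite raddfB /= euler1 subr0.
pose c k := k%:R * gbinom s k.
have /= e1 := fps_subst_shift c w0.
have e2 : fps_subst (fun k => c k.+1 + c k) w = fpsC s * fps_subst (gbinom s) w.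
  rewrite -fps_substZ; congr (fps_subst _ _); apply/funext => k.
  by rewrite /c gbinomS; ring.
have c0 : fpsC (c 0%N) = 0 by rewrite /c mul0r rmorph0.
have -> : f = w + 1 by rewrite /w subrK.
rewrite mulrCA mulrDl e1 mul1r c0 subr0 addrC -fps_substD e2; ring.
Qed.

End FpsRing.

(** * Bernoulli-Norlund polynomials and the right-hand side *)

Section BernoulliNorlund.
Variable C : numFieldType.
Implicit Types (a s z w : C) (k n : nat).
Local Notation fps := (fps C).
Local Notation T := (@todd C : fps).
Local Notation X := (@fpsX C).

Lemma poch0 a : poch a 0 = 1.
Proof. by rewrite /poch big_ord0. Qed.

Lemma pochSl a k : poch a k.+1 = a * poch (a + 1) k.
Proof.
rewrite /poch big_ord_recl addr0; congr (_ * _); apply: eq_bigr => i _.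
by rewrite -addrA nat1r.
Qed.

Lemma pochSr a k : poch a k.+1 = poch a k * (a + k%:R).
Proof. by rewrite /poch big_ord_recr. Qed.

Definition todd_inv : fps := fun k => ((k.+1)`!)%:R^-1.

Definition expz z : fps := exp_series z.
Local Notation H := todd_inv.

Lemma natr_fact_neq0 k : (k`!)%:R != 0 :> C.
Proof. by rewrite pnatr_eq0 -lt0n fact_gt0. Qed.

Let natS_neq0 k : k.+1%:R != 0 :> C.
Proof. by rewrite pnatr_eq0. Qed.

Lemma toddK : T * H = 1.
Proof. by rewrite mulrC fps_mulV // /todd_inv factS fact0 invr1. Qed.

Lemma todd0 : T 0%N = 1.
Proof.
have /(congr1 (fun f : fps => f 0%N)) := toddK.
by rewrite fpsM0 /todd_inv factS fact0 invr1 mulr1.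
Qed.

Lemma expz0E z : expz z 0%N = 1.
Proof. by rewrite /expz /exp_series expr0 fact0 divr1. Qed.

Lemma euler_expz z : euler (expz z) = fpsC z * X * expz z.
Proof.
apply/funext => -[|n]; rewrite -mulrA fpsCM fpsXM /euler ?mul0r ?mulr0 //.
rewrite /expz /exp_series factS natrM exprS.
by field; rewrite natr_fact_neq0 nat1r natS_neq0.
Qed.

Lemma expzD z w : expz (z + w) = expz z * expz w.
Proof.
apply: (@euler_ode_uniq _ (fpsC (z + w) * X)).
- by rewrite fpsCM /fpsX mulr0.
- by rewrite fpsM0 !expz0E mulr1.
- exact: euler_expz.
- by rewrite eulerM !euler_expz rmorphD /=; ring.
Qed.

Lemma expz1 : expz 1 = 1 + X * H.
Proof.
apply/funext => -[|n]; rewrite fpsD fpsXM ?expz0E ?addr0 // add0r.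
by rewrite /expz /exp_series expr1n mul1r.
Qed.

(** This is the derivative of t H = e^t - 1. *)
Lemma euler_H : euler H + H = expz 1.
Proof.
apply/funext => n.
rewrite fpsD /euler /expz /exp_series expr1n /todd_inv factS natrM.
by field; rewrite natr_fact_neq0 nat1r natS_neq0.
Qed.

(** Differentiating T H = 1 gives this Riccati equation, so the logarithmic derivative of T^s is s
    (1 - t - T), with no inverse left. *)
Lemma euler_todd : euler T = T * (1 - X - T).
Proof.
have e1 : euler T * H + T * euler H = 0 by rewrite -eulerM toddK euler1.
have e2 : euler H = 1 + X * H - H by rewrite -expz1 -euler_H addrK.
rewrite -[LHS]mulr1 -toddK mulrCA mulrC.
have -> : euler T * H = - (T * (1 + X * H - H)).
  by apply/eqP; rewrite -addr_eq0 -e2 e1.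
have -> : - (T * (1 + X * H - H)) * T =
  T * (T * H) - T * X * (T * H) - T * T by ring.
by rewrite toddK; ring.
Qed.

Definition toddX s : fps := fps_cpow T s.

Lemma euler_toddX s : euler (toddX s) = fpsC s * (1 - X - T) * toddX s.
Proof.
have := euler_cpow s todd0; rewrite euler_todd -/(toddX s) => e.
rewrite -[LHS]mul1r -toddK mulrAC e.
have -> : fpsC s * (T * (1 - X - T)) * toddX s * H =
  (T * H) * (fpsC s * (1 - X - T) * toddX s) by ring.
by rewrite toddK mul1r.
Qed.

Lemma toddX0E s : toddX s 0%N = 1.
Proof. exact: fps_cpow0. Qed.

Let kappa0 s : (fpsC s * (1 - X - T)) 0%N = 0.
Proof. by rewrite fpsCM !fpsB todd0 /fpsX subr0 subrr mulr0. Qed.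

Lemma toddXS s : toddX (s + 1) = T * toddX s.
Proof.
apply: (@euler_ode_uniq _ (fpsC (s + 1) * (1 - X - T))).
- exact: kappa0.
- by rewrite fpsM0 !toddX0E todd0 mulr1.
- exact: euler_toddX.
- by rewrite eulerM euler_toddX euler_todd rmorphD rmorph1; ring.
Qed.

Lemma toddX0 : toddX 0 = 1.
Proof.
apply: (@euler_ode_uniq _ (fpsC 0 * (1 - X - T))).
- exact: kappa0.
- by rewrite toddX0E.
- exact: euler_toddX.
- by rewrite euler1 rmorph0 !mul0r.
Qed.

(** * Contiguity relations of the Bernoulli-Norlund polynomials *)

Definition bern_series s z : fps := toddX s * expz z.

Lemma gen_bernoulliE s k z : gen_bernoulli s k z = (k`!)%:R * bern_series s z k.
Proof. by []. Qed.

Lemma bern_series0 s z : bern_series s z 0%N = 1.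
Proof. by rewrite /bern_series fpsM0 toddX0E expz0E mulr1. Qed.

(** The logarithmic derivative of T^s e^(zt) is s (1 - t - T) + z t; its term in T raises the order
    to s + 1, and the equation is solved for that term. *)
Lemma bern_seriesS s z : fpsC s * bern_series (s + 1) z =
  fpsC s * bern_series s z - euler (bern_series s z)
  + fpsC (z - s) * X * bern_series s z.
Proof.
by rewrite /bern_series eulerM euler_toddX euler_expz toddXS rmorphB /=; ring.
Qed.

(** From e^t = 1 + t H and T H = 1. *)
Lemma bern_series_shift s z :
  bern_series (s + 1) (z + 1) = bern_series (s + 1) z + X * bern_series s z.
Proof.
rewrite /bern_series toddXS expzD expz1.
have -> : T * toddX s * (expz z * (1 + X * H)) =
  T * toddX s * expz z + (T * H) * (X * (toddX s * expz z)) by ring.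
by rewrite toddK mul1r.
Qed.

Lemma bernoulli_shift k z :
  bernoulli k.+1 (z + 1) = bernoulli k.+1 z + k.+1%:R * z ^+ k.
Proof.
have := bern_series_shift 0 z; rewrite add0r => e.
rewrite /bernoulli !gen_bernoulliE e fpsD fpsXM mulrDr; congr (_ + _).
rewrite /bern_series toddX0 mul1r /expz /exp_series factS natrM.
by field; rewrite natr_fact_neq0.
Qed.

(* Formally, s^(alpha - v - r) is the sum over n >= r of
   inv_fact_series alpha (v + n) (n - r) * Gamma(s + alpha) / Gamma(s + v + n). *)
Definition inv_fact_series alpha w : fps :=
  fun k => poch (1 + alpha - w) k * bern_series (w - alpha) (1 - alpha) k.

(** Splitting the factor -s off [poch (- s) k.+1], with s = w - 1 - alpha, leaves s B^(s+1), which
    [bern_seriesS] reduces to order s. *)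
Lemma inv_fact_series_pred alpha w :
  inv_fact_series alpha (w - 1) =
  inv_fact_series alpha w - fpsC (w - 2) * (X * inv_fact_series alpha (w - 1)).
Proof.
apply/funext => -[|k]; rewrite fpsB fpsCM fpsXM /inv_fact_series.
  by rewrite !poch0 !bern_series0 mulr0 subr0.
set s := w - 1 - alpha.
have -> : 1 + alpha - w = - s by rewrite /s; ring.
have -> : 1 + alpha - (w - 1) = 1 - s by rewrite /s; ring.
have -> : w - alpha = s + 1 by rewrite /s; ring.
have /(congr1 (fun f : fps => f k.+1)) := bern_seriesS s (1 - alpha).
rewrite fpsD fpsB -mulrA !fpsCM fpsXM /euler => e.
rewrite [poch (1 - s) _.+1]pochSr [poch (- s) _]pochSl [- s + 1]addrC.
rewrite -natr1 in e.
have -> : - s * poch (1 - s) k * bern_series (s + 1) (1 - alpha) k.+1 =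
  - (poch (1 - s) k * (s * bern_series (s + 1) (1 - alpha) k.+1)) by ring.
by rewrite e /s; ring.
Qed.

(** Formal trace of Gamma(s + alpha + 1) = (s + alpha) Gamma(s + alpha). The argument 1 - alpha is
    first moved to -alpha, then the order is lowered as in [inv_fact_series_pred]. *)
Lemma inv_fact_series_shift alpha w :
  inv_fact_series (alpha + 1) w * (1 + fpsC alpha * X) = inv_fact_series alpha w.
Proof.
rewrite mulrDr mulr1 mulrCA [_ * X]mulrC.
apply/funext => -[|k]; rewrite fpsD fpsCM fpsXM /inv_fact_series.
  by rewrite !poch0 !bern_series0 mulr0 addr0.
set s := w - (alpha + 1).
have -> : 1 + alpha - w = - s by rewrite /s; ring.
have -> : 1 + (alpha + 1) - w = 1 - s by rewrite /s; ring.
have -> : w - alpha = s + 1 by rewrite /s; ring.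
have -> : 1 - (alpha + 1) = - alpha by ring.
have /(congr1 (fun f : fps => f k.+1)) := bern_seriesS s (- alpha).
rewrite fpsD fpsB -mulrA !fpsCM fpsXM /euler => e.
have -> : 1 - alpha = - alpha + 1 by ring.
rewrite bern_series_shift fpsD fpsXM.
rewrite [poch (1 - s) _.+1]pochSr [poch (- s) _]pochSl [- s + 1]addrC.
rewrite -natr1 in e.
set A := bern_series (s + 1) (- alpha) k.+1 in e *.
set B := bern_series s (- alpha) k in e *.
have -> : - s * poch (1 - s) k * (A + B) =
  - (poch (1 - s) k * (s * A)) - s * poch (1 - s) k * B by ring.
by rewrite e; ring.
Qed.

(* The part of the Stirling series of log Gamma(s + a) that depends on a, in
   the variable t = 1 / s. *)
Definition stirling a : fps := fun m =>
  if m == 0%N then 0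
  else (-1) ^+ m.+1 / (m%:R * m.+1%:R) * bernoulli m.+1 a.

Definition log1p a : fps := fun m =>
  if m == 0%N then 0 else (-1) ^+ m.+1 * a ^+ m / m%:R.

(** The Euler derivative of log(1 + a t) is a geometric series, which the factor 1 + a t collapses
    to a t. *)
Lemma exp_log1p a : fps_exp (log1p a) = (1 + fpsC a * X : fps).
Proof.
have e m : euler (log1p a) m =
    if m == 0%N then 0 else (-1) ^+ m.+1 * a ^+ m.
  rewrite /euler /log1p; case: m => [|m]; rewrite ?mul0r //=.
  by rewrite mulrC divfK.
apply: (@euler_ode_uniq _ (euler (log1p a))).
- by rewrite e.
- by rewrite fps_exp0 fpsD fpsCM mulr0 addr0.
- exact: euler_fps_exp.
rewrite raddfD /= euler1 eulerM eulerC eulerX mul0r !add0r.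
have -> : euler (log1p a) * (1 + fpsC a * X) =
  euler (log1p a) + fpsC a * (X * euler (log1p a)) by ring.
apply/funext => m; rewrite fpsD !fpsCM fpsXM e.
case: m => [|[|m]] /=; rewrite ?mulr0 ?addr0 //.
  by rewrite /fpsX /= e mulr0 addr0 expr1 sqrrN expr1n mulr1 mul1r.
by rewrite /fpsX e /= !exprS; ring.
Qed.

(** The difference equation of the Bernoulli polynomials is the logarithm of Gamma(s + a + 1) = (s +
    a) Gamma(s + a), read in t = 1 / s. *)
Lemma stirling_shift a : stirling (a + 1) = stirling a + log1p a.
Proof.
apply/funext => -[|m]; rewrite fpsD /stirling /log1p /= ?addr0 //.
rewrite bernoulli_shift mulrDr; congr (_ + _).
by field; rewrite ?nat1r ?natS_neq0 -?natrD ?pnatr_eq0.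
Qed.

Lemma exp_stirling_shift (Q : fps) a : Q 0%N = 0 ->
  fps_exp (Q + stirling (a + 1)) =
  (fps_exp (Q + stirling a) : fps) * (1 + fpsC a * X).
Proof.
move=> Q0; rewrite stirling_shift addrA.
rewrite (@fps_expD _ (Q + stirling a)) ?exp_log1p //.
by rewrite fpsD Q0 addr0.
Qed.

(** For [v] = nu and [Q] the signed sum of Stirling series this is the right-hand side of the
    theorem, since coefficient r of exp Q is Y_r / r!. Leaving [Q] free lets one parameter move at a
    time. *)
Definition norlund_rhs (Q : fps) alpha v n : C :=
  ((fps_exp Q : fps) * inv_fact_series alpha (v + n%:R)) n.

Lemma norlund_rhs_shift_alpha (Q : fps) alpha v n : Q 0%N = 0 ->
  norlund_rhs (Q + stirling (alpha + 1)) (alpha + 1) v n =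
  norlund_rhs (Q + stirling alpha) alpha v n.
Proof.
move=> Q0; rewrite /norlund_rhs exp_stirling_shift //.
by rewrite -mulrA [(1 + _) * _]mulrC inv_fact_series_shift.
Qed.

(** Raising one x by 1 lowers nu by 1. The exponential gains the factor 1 + a t, and
    [inv_fact_series_pred] accounts for the change of nu. *)
Lemma norlund_rhs_shift (Q : fps) alpha v a n : Q 0%N = 0 ->
  norlund_rhs (Q + stirling (a + 1)) alpha (v - 1) n =
  norlund_rhs (Q + stirling a) alpha v n
  - (if n is m.+1
     then (v + n%:R - 2 - a) * norlund_rhs (Q + stirling a) alpha v m else 0).
Proof.
move=> Q0; rewrite /norlund_rhs exp_stirling_shift //.
set E : fps := fps_exp _.
have -> : v - 1 + n%:R = v + n%:R - 1 by ring.
set D := inv_fact_series alpha (v + n%:R - 1).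
set D' := inv_fact_series alpha (v + n%:R); set c := v + n%:R - 2.
have eD : D = D' - fpsC c * (X * D) by exact: inv_fact_series_pred.
have -> : E * (1 + fpsC a * X) * D = E * D' - fpsC (c - a) * (X * (E * D)).
  transitivity (E * D + fpsC a * (X * (E * D))); first by ring.
  by rewrite {1}eD [fpsC (c - a)]rmorphB; ring.
rewrite fpsB fpsCM fpsXM; congr (_ - _); clear D' eD; rewrite {}/c {}/D.
(* The same series [D] belongs to index n at v - 1 and to index n - 1 at v. *)
case: n => [|n]; first by rewrite mulr0.
by have -> : v + n.+1%:R - 1 = v + n%:R by rewrite -natr1; ring.
Qed.

End BernoulliNorlund.

(** * Density of the integers *)

Section PolynomialFunctions.
Variable C : numFieldType.
Implicit Types (f g : C -> C) (F G : C -> fps C).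

Definition polyfun f := exists p : {poly C}, forall t, f t = p.[t].

Lemma polyfun_const a : polyfun (fun=> a).
Proof. by exists a%:P => t; rewrite hornerC. Qed.

Lemma polyfun_id : polyfun id.
Proof. by exists 'X => t; rewrite hornerX. Qed.

Lemma polyfunD f g : polyfun f -> polyfun g -> polyfun (fun t => f t + g t).
Proof. by move=> [p fp] [q gq]; exists (p + q) => t; rewrite hornerD fp gq. Qed.

Lemma polyfunM f g : polyfun f -> polyfun g -> polyfun (fun t => f t * g t).
Proof. by move=> [p fp] [q gq]; exists (p * q) => t; rewrite hornerM fp gq. Qed.

Lemma polyfunN f : polyfun f -> polyfun (fun t => - f t).
Proof. by move=> [p fp]; exists (- p) => t; rewrite hornerN fp. Qed.

Lemma polyfunB f g : polyfun f -> polyfun g -> polyfun (fun t => f t - g t).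
Proof. by move=> pf pg; apply/polyfunD/polyfunN. Qed.

Lemma polyfun_sum (I : Type) (r : seq I) (P : pred I) (f : I -> C -> C) :
  (forall i, polyfun (f i)) -> polyfun (fun t => \sum_(i <- r | P i) f i t).
Proof.
move=> pf; elim: r => [|i r [p IH]].
  by exists 0 => t; rewrite big_nil horner0.
have [q fq] := pf i; exists ((if P i then q else 0) + p) => t.
by rewrite big_cons hornerD IH fq; case: ifP; rewrite ?horner0 ?add0r.
Qed.

Lemma polyfun_prod (I : Type) (r : seq I) (P : pred I) (f : I -> C -> C) :
  (forall i, polyfun (f i)) -> polyfun (fun t => \prod_(i <- r | P i) f i t).
Proof.
move=> pf; elim: r => [|i r [p IH]].
  by exists 1 => t; rewrite big_nil hornerC.
have [q fq] := pf i; exists ((if P i then q else 1) * p) => t.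
by rewrite big_cons hornerM IH fq; case: ifP; rewrite ?hornerC ?mul1r.
Qed.

(** In characteristic zero the points a + i are distinct, so the difference polynomial has as many
    roots as its size and must vanish. *)
Lemma polyfun_eq a f g : polyfun f -> polyfun g ->
  (forall N, f (a + N%:R) = g (a + N%:R)) -> f =1 g.
Proof.
move=> [p fp] [q gq] e t; apply/eqP; rewrite -subr_eq0 fp gq -hornerN -hornerD.
suff -> : p - q = 0 by rewrite horner0.
pose rs := [seq a + i%:R | i <- iota 0 (size (p - q))].
apply: (@roots_geq_poly_eq0 _ _ rs).
- apply/allP => _ /mapP [i _ ->].
  by rewrite /root hornerD hornerN -fp -gq e subrr.
- rewrite map_inj_uniq ?iota_uniq // => i j /addrI /eqP.
  by rewrite eqr_nat => /eqP.
- by rewrite size_map size_iota.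
Qed.

Lemma polyfun_poch f k : polyfun f -> polyfun (fun t => poch (f t) k).
Proof. by move=> pf; apply: polyfun_prod => i; apply/polyfunD/polyfun_const. Qed.

(** Polynomiality is asked coefficientwise: the degree may grow with [n]. *)
Definition polyfps F := forall n, polyfun (fun t => F t n).

Lemma polyfps_const (h : fps C) : polyfps (fun=> h).
Proof. by move=> n; apply: polyfun_const. Qed.

Lemma polyfpsD F G : polyfps F -> polyfps G -> polyfps (fun t => F t + G t).
Proof. by move=> pF pG n; apply: polyfunD. Qed.

Lemma polyfpsM F G : polyfps F -> polyfps G -> polyfps (fun t => F t * G t).
Proof. by move=> pF pG n; apply: polyfun_sum => i; apply: polyfunM. Qed.

Lemma polyfpsX F k : polyfps F -> polyfps (fun t => F t ^+ k).
Proof.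
move=> pF; elim: k => [|k IH]; first exact: polyfps_const.
move=> n; have [p e] := polyfpsM pF IH n; exists p => t.
by rewrite -e exprS.
Qed.

Lemma polyfps_subst (c : C -> nat -> C) F :
  (forall k, polyfun (fun t => c t k)) -> polyfps F ->
  polyfps (fun t => fps_subst (c t) (F t)).
Proof.
by move=> pc pF n; apply: polyfun_sum => k; apply/polyfunM/(polyfpsX k pF n).
Qed.

Lemma polyfps_exp F : polyfps F -> polyfps (fun t => fps_exp (F t)).
Proof.
move=> pF n; have [|p e] := @polyfps_subst (fun=> fun k => (k`!)%:R^-1) F _ pF n.
  by move=> k; apply: polyfun_const.
by exists p => t; rewrite -e fps_expE.
Qed.

(** Polynomiality in the order holds because [gbinom s k] is a polynomial in s. *)
Lemma polyfps_bern_series f g : polyfun f -> polyfun g ->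
  polyfps (fun t => bern_series (f t) (g t)).
Proof.
move=> pf pg; apply: polyfpsM => n.
  have [|p e] := @polyfps_subst (fun t => gbinom (f t))
                   (fun=> (todd C : fps C) - 1) _ (@polyfps_const _) n.
    move=> k; apply: polyfunM; last exact: polyfun_const.
    by apply: polyfun_prod => i; apply/polyfunD/polyfun_const.
  by exists p => t; rewrite -e /toddX fps_cpowE.
have [p gp] := pg; exists (p ^+ n * (n`!%:R^-1)%:P) => t.
by rewrite hornerM hornerC horner_exp -gp.
Qed.

Lemma polyfps_inv_fact_series f g : polyfun f -> polyfun g ->
  polyfps (fun t => inv_fact_series (f t) (g t)).
Proof.
move=> pf pg n; apply: polyfunM.
  by apply/polyfun_poch/polyfunB => //; apply/polyfunD => //; apply: polyfun_const.
apply: (polyfps_bern_series (f := fun t => g t - f t) (g := fun t => 1 - f t)).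
  exact: polyfunB.
by apply: polyfunB => //; apply: polyfun_const.
Qed.

Lemma polyfps_stirling f : polyfun f -> polyfps (fun t => stirling (f t)).
Proof.
move=> pf [|n]; first exact: polyfun_const.
apply: polyfunM; first exact: polyfun_const.
apply: polyfunM; first exact: polyfun_const.
exact: (polyfps_bern_series (f := fun=> 1) (polyfun_const 1) pf).
Qed.

Lemma polyfun_norlund_rhs F f g n : polyfps F -> polyfun f -> polyfun g ->
  polyfun (fun t => norlund_rhs (F t) (f t) (g t) n).
Proof.
move=> pF pf pg.
apply: (polyfpsM (F := fun t => fps_exp (F t)) (polyfps_exp pF)).
apply: polyfps_inv_fact_series => //.
by apply: polyfunD => //; apply: polyfun_const.
Qed.

End PolynomialFunctions.

(** * The formula for the Norlund coefficients *)

Section NorlundFormula.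
Variable C : numFieldType.
Implicit Types (x y v alpha : C) (g : nat -> C) (Q : fps C).

(** One step of the recursion with the new parameters free. Here [v] stands for psi of the previous
    level, which does not involve the new [x]; then [v - x] is nu. *)
Definition norlund_step g y x v n : C :=
  \sum_(m < n.+1) poch (y - x) (n - m) / ((n - m)`!)%:R
    * poch (v - x + m%:R) (n - m) * g m.

Lemma norlund_step_id g y v n : norlund_step g y y v n = g n.
Proof.
rewrite /norlund_step big_ord_recr /= subnn poch0 fact0 divr1 mul1r poch0 mul1r.
rewrite big1 ?add0r // => i _; rewrite subrr -(subnSK (ltn_ord i)) pochSl.
by rewrite !mul0r.
Qed.

(** Termwise, this is (a - 1)(b - 1) = (a + k)(b + k) - (k + 1)(a + b + k - 1). The recurrence
    matches [norlund_rhs_shift]. *)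
Lemma norlund_step_shift g y x v n :
  norlund_step g y (x + 1) v n =
  norlund_step g y x v n
  - (if n is m.+1
     then (v + y - x + n%:R - 2 - x) * norlund_step g y x v m else 0).
Proof.
case: n => [|n]; first by rewrite /norlund_step !big_ord1 !poch0 subr0.
rewrite /norlund_step ![\sum_(m < n.+2) _]big_ord_recr /= subnn !poch0.
rewrite addrAC mulr_sumr -sumrB; congr (_ + _); apply: eq_bigr => m _.
have lemn : (m <= n)%N by rewrite -ltnS.
rewrite (subSn lemn); set k := (n - m)%N.
have -> : y - (x + 1) = y - x - 1 by ring.
have -> : v - (x + 1) + m%:R = v - x + m%:R - 1 by ring.
set a := y - x; set b := v - x + m%:R.
have -> : v + y - x + n.+1%:R - 2 - x = a + b + k%:R - 1.
  by rewrite /a /b /k -natr1 natrB //; ring.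
rewrite ![poch (_ - 1) _]pochSl !subrK !pochSr factS natrM -natr1.
have k0 : k%:R + 1 != 0 :> C by rewrite natr1 pnatr_eq0.
have kf : (k`!)%:R != 0 :> C by rewrite pnatr_eq0 -lt0n fact_gt0.
by field; rewrite kf k0.
Qed.

Lemma norlund_step_rhs Q alpha y v g : Q 0%N = 0 ->
  (forall n, g n = norlund_rhs Q alpha v n) ->
  forall x n, norlund_step g y x v n =
    norlund_rhs (Q - stirling y + stirling x) alpha (v + y - x) n.
Proof.
move=> Q0 eg x n; move: x.
apply: (@polyfun_eq _ y).
- apply: polyfun_sum => m; apply: polyfunM; last exact: polyfun_const.
  apply: polyfunM; first apply: polyfunM; try exact: polyfun_const.
    by apply/polyfun_poch/polyfunB/polyfun_id/polyfun_const.
  apply/polyfun_poch/polyfunD/polyfun_const/polyfunB/polyfun_id.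
  exact: polyfun_const.
- apply: (polyfun_norlund_rhs n (f := fun=> alpha) (g := fun t => v + y - t)).
  + apply: polyfpsD; first exact: polyfps_const.
    exact: (polyfps_stirling (@polyfun_id C)).
  + exact: polyfun_const.
  + by apply/polyfunB/polyfun_id/polyfun_const.
have Qy0 : (Q - stirling y) 0%N = 0 by rewrite fpsB Q0 subr0.
(* The induction on [N] keeps [n] general, because the recurrence also calls index n - 1 at the same
   x. *)
move=> N; elim: N n => [|N IH] n.
  by rewrite addr0 norlund_step_id eg subrK addrK.
rewrite -natr1 addrA; set x := y + N%:R in IH *.
have -> : v + y - (x + 1) = v + y - x - 1 by ring.
rewrite norlund_step_shift norlund_rhs_shift // IH.
by case: n => // n; rewrite IH.
Qed.

Lemma norlund_rhs_delta y alpha n :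
  norlund_rhs (- stirling y + stirling alpha) alpha y n = (n == 0%N)%:R.
Proof.
move: alpha.
apply: (@polyfun_eq _ y _ (fun=> (n == 0%N)%:R)).
- apply: (polyfun_norlund_rhs n (f := id) (g := fun=> y)).
  + apply: polyfpsD; first exact: polyfps_const.
    exact: (polyfps_stirling (@polyfun_id C)).
  + exact: polyfun_id.
  + exact: polyfun_const.
- exact: polyfun_const.
elim=> [|N IH]; last first.
  by rewrite -natr1 addrA norlund_rhs_shift_alpha // fpsN oppr0.
(* At alpha = y the exponent is zero, and for n > 0 the factor (1 - n)_n vanishes. *)
rewrite addr0 addNr /norlund_rhs.
have -> : fps_exp (0 : fps C) = (1 : fps C).
  apply: (@euler_ode_uniq _ 0) => //; rewrite ?mul0r ?euler1 ?fps_exp0 //.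
  by rewrite euler_fps_exp // raddf0 mul0r.
rewrite mul1r /inv_fact_series; case: n => [|n].
  by rewrite poch0 bern_series0 mulr1.
have -> : 1 + y - (y + n.+1%:R) = - n%:R by rewrite -natr1; ring.
by rewrite poch_oppn_eq0 ?mul0r.
Qed.

Lemma nuE (x y : nat -> C) p : nu x y p.+1 = psi x y p.+1 - x p.+1.
Proof. by rewrite /nu /psi sumrB [in X in _ - X]big_nat_recr //= opprD addrA. Qed.

Lemma psiS (x y : nat -> C) p : psi x y p.+2 = psi x y p.+1 + y p.+2 - x p.+1.
Proof.
rewrite /psi big_nat_recr //= [X in _ - X]big_nat_recr //=; ring.
Qed.

Lemma norlundSS (x y : nat -> C) p n : norlund p.+2 n x y =
  norlund_step (fun m => norlund p.+1 m x y) (y p.+2) (x p.+1) (psi x y p.+1) n.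
Proof. by rewrite /norlund_step -nuE. Qed.

Lemma norlundE (x y : nat -> C) alpha p n :
  norlund p.+1 n x y =
  norlund_rhs (stirling alpha + \sum_(1 <= k < p.+1) stirling (x k)
               - \sum_(1 <= k < p.+2) stirling (y k)) alpha (psi x y p.+1) n.
Proof.
elim: p n => [|p IH] n.
  rewrite big_geq // big_nat1 addr0 addrC /psi big_nat1 big_geq // subr0.
  by rewrite norlund_rhs_delta.
rewrite norlundSS; set Q := (X in norlund_rhs X) in IH.
rewrite (norlund_step_rhs (Q := Q) (alpha := alpha)) //; last first.
  rewrite /Q fpsB fpsD !fps_sumE.
  by rewrite !big1 ?addr0 ?subr0.
rewrite -psiS; congr norlund_rhs.
rewrite [\sum_(1 <= k < p.+2) stirling (x k)]big_nat_recr //.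
rewrite [\sum_(1 <= k < p.+3) _]big_nat_recr // /Q /=.
move: (\sum_(1 <= k < p.+1) _) (\sum_(1 <= k < p.+2) _) => a b; ring.
Qed.

End NorlundFormula.

(** * Multiple sums as iterated recursions *)

Section TupleSums.
Variable C : numFieldType.
Implicit Types (K : nat -> nat -> nat -> C) (q s n : nat) (l : seq nat).

(** Sum over paths from 0 to [n] in [q] steps, where [K s i k] weighs step [s] from partial sum [i]
    to [i + k]. *)
Fixpoint chain K q n : C :=
  if q is q'.+1 then \sum_(i < n.+1) chain K q' i * K q' i (n - i)%N
  else (n == 0%N)%:R.

Let weight K q l : C := \prod_(0 <= s < q) K s (sumn (take s l)) (nth 0%N l s).

Let weight_rcons K q l i : size l = q ->
  weight K q.+1 (rcons l i) = weight K q l * K q (sumn l) i.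
Proof.
move=> sl; rewrite /weight big_nat_recr //= -[in take q _]sl -cats1 take_size_cat //.
rewrite nth_cat sl ltnn subnn; congr (_ * _); apply: eq_big_nat => s /andP [_ lts].
by rewrite nth_cat sl lts takel_cat // sl ltnW.
Qed.

Lemma big_tuple_rcons (T : finType) q (P : pred (seq T)) (F : seq T -> C) :
  \sum_(l : q.+1.-tuple T | P l) F l =
  \sum_(l : q.-tuple T) \sum_(i : T | P (rcons l i)) F (rcons l i).
Proof.
rewrite (reindex (fun li : q.-tuple T * T => rcons_tuple li.1 li.2)) /=.
  by rewrite -(pair_big_dep xpredT (fun (l : q.-tuple T) i => P (rcons l i))
                 (fun (l : q.-tuple T) i => F (rcons l i))).
apply/onW_bij/inj_card_bij; last by rewrite card_prod !card_tuple expnSr.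
move=> [l i] [l' i'] /(congr1 val) /= /rcons_inj [e ->].
by congr (_, _); apply: val_inj.
Qed.

(** The bound [N] on the entries stays fixed while the total [j] varies in the induction; splitting
    off the last entry gives one step of [chain]. *)
Let weight_sum K q N j : (j <= N)%N ->
  \sum_(l : q.-tuple 'I_N.+1 | sumn (map val l) == j) weight K q (map val l) =
  chain K q j.
Proof.
elim: q j => [|q IH] j lejN.
  rewrite big_mkcond (big_pred1 [tuple]) => [|l]; last by apply/esym/eqP/tuple0.
  by rewrite /weight big_geq //= eq_sym; case: eqP.
rewrite (big_tuple_rcons q (fun l : seq 'I_N.+1 => sumn (map val l) == j)
           (fun l : seq 'I_N.+1 => weight K q.+1 (map val l))) /=.
transitivity (\sum_(l : q.-tuple 'I_N.+1) \sum_(i < j.+1 | sumn (map val l) == i)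
    weight K q (map val l) * K q i (j - i)%N); last first.
  rewrite (exchange_big_dep predT) //=; apply: eq_bigr => i _.
  rewrite -IH; last by rewrite (leq_trans _ lejN) // -ltnS.
  by rewrite mulr_suml.
apply: eq_bigr => l _; set t := sumn _.
have eW i : weight K q.+1 (map val (rcons l i)) = weight K q (map val l) * K q t i.
  by rewrite map_rcons weight_rcons // size_map size_tuple.
under eq_bigl => i do rewrite map_rcons sumn_rcons -/t.
under eq_bigr => i _ do rewrite eW.
(* For t > j both sums are empty; otherwise each has exactly one term, with last entry j - t on the
   left and i = t on the right. *)
have [let_|ltj] := leqP t j; last first.
  rewrite !big_pred0 // => i; apply/negbTE; rewrite neq_ltn.
    by rewrite (leq_trans (ltn_ord i)) ?orbT.
  by rewrite (leq_trans ltj) ?leq_addr ?orbT.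
have lt1 : (j - t < N.+1)%N by rewrite ltnS (leq_trans (leq_subr _ _)).
rewrite (big_pred1 (Ordinal lt1)) => [|i]; last first.
  by rewrite -[RHS](inj_eq val_inj) /= -[RHS](eqn_add2l t) subnKC.
rewrite (big_pred1 (Ordinal (let_ : t < j.+1)%N)) => [|i] //=.
by rewrite -[RHS](inj_eq val_inj) eq_sym.
Qed.

(** The [q] free entries and the determined last entry n - |l| make [q.+1] steps ending at [n]. *)
Lemma chain_tuple_sum K q n (F : seq nat -> C) :
  (forall l, (n < sumn l)%N -> F l = 0) ->
  (forall l, size l = q -> (sumn l <= n)%N ->
     F l = \prod_(0 <= s < q.+1)
       K s (partial n l s) (nth 0%N (full_index n l) s)) ->
  \sum_(l : q.-tuple 'I_n.+1) F (map val l) = chain K q.+1 n.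
Proof.
move=> F0 FE.
transitivity (\sum_(l : q.-tuple 'I_n.+1) \sum_(i < n.+1 | sumn (map val l) == i)
    weight K q (map val l) * K q i (n - i)%N); last first.
  rewrite (exchange_big_dep predT) //=; apply: eq_bigr => i _.
  rewrite -(weight_sum _ _ (_ : (i <= n)%N)); last by rewrite -ltnS.
  by rewrite mulr_suml.
apply: eq_bigr => l _; set t := map val l.
have st : size t = q by rewrite size_map size_tuple.
have [let_|ltn_] := leqP (sumn t) n; last first.
  rewrite F0 // big_pred0 // => i; apply/negbTE; rewrite neq_ltn.
  by rewrite (leq_trans (ltn_ord i)) ?orbT.
rewrite (big_pred1 (Ordinal (let_ : sumn t < n.+1)%N)) => [|i]; last first.
  by rewrite -[RHS](inj_eq val_inj) eq_sym.
by rewrite FE // -(weight_rcons _ _ st).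
Qed.

End TupleSums.

(** * Chu-Vandermonde sums *)

Section PochhammerSums.
Variable C : numFieldType.
Implicit Types (a b c T P Q f : C) (k n N : nat).

Lemma sum_binSn n (G : nat -> C) :
  \sum_(k < n.+2) 'C(n.+1, k)%:R * G k =
  \sum_(k < n.+1) 'C(n, k)%:R * (G k + G k.+1).
Proof.
under [RHS]eq_bigr => k _ do rewrite mulrDr.
rewrite big_split /= big_ord_recl bin0.
have -> : \sum_(i < n.+1) 'C(n.+1, lift ord0 i)%:R * G (lift ord0 i) =
    \sum_(i < n.+1) 'C(n, i.+1)%:R * G i.+1 + \sum_(i < n.+1) 'C(n, i)%:R * G i.+1.
  by rewrite -big_split; apply: eq_bigr => i _; rewrite lift0 binS natrD mulrDl.
rewrite addrA; congr (_ + _).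
rewrite [in RHS]big_ord_recl bin0; congr (_ + _).
by rewrite big_ord_recr /= bin_small // mul0r addr0.
Qed.

Lemma natr_bin n k : (k <= n)%N ->
  'C(n, k)%:R = (n`!)%:R / ((k`!)%:R * ((n - k)`!)%:R) :> C.
Proof.
move=> lekn; rewrite -(bin_fact lekn) natrM natrM mulfK //.
by rewrite mulf_neq0 ?natr_fact_neq0.
Qed.

(** Chu-Vandermonde. By Pascal's rule, terms k and k + 1 combine with the factor (b + n - k) + (a +
    k) = a + b + n. *)
Lemma poch_add a b n :
  poch (a + b) n = \sum_(k < n.+1) 'C(n, k)%:R * (poch a k * poch b (n - k)).
Proof.
elim: n => [|n IH]; first by rewrite big_ord1 !poch0 bin0 !mulr1.
rewrite (sum_binSn n (fun k => poch a k * poch b (n.+1 - k))).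
rewrite pochSr IH mulr_suml; apply: eq_bigr => k _.
have lekn : (k <= n)%N by rewrite -ltnS.
by rewrite subSS (subSn lekn) !pochSr natrB //; ring.
Qed.

(** Chu-Vandermonde for 2F1(-n, b; a; 1), cleared of denominators. The second term of its recurrence
    uses the pair (a + 1, b + 1), hence the induction for all [a] and [b]. *)
Lemma poch_sub a b n :
  poch (a - b) n =
  \sum_(k < n.+1) 'C(n, k)%:R * ((-1) ^+ k * poch b k * poch (a + k%:R) (n - k)).
Proof.
elim: n a b => [|n IH] a b; first by rewrite big_ord1 !poch0 bin0 !mulr1.
rewrite (sum_binSn n (fun k => (-1) ^+ k * poch b k * poch (a + k%:R) (n.+1 - k))).
have -> : poch (a - b) n.+1 =
    (a + n%:R) * poch (a - b) n - b * poch ((a + 1) - (b + 1)) n.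
  have -> : a + 1 - (b + 1) = a - b by ring.
  by rewrite pochSr; ring.
rewrite !IH !mulr_sumr -sumrB; apply: eq_bigr => k _.
have lekn : (k <= n)%N by rewrite -ltnS.
rewrite subSS (subSn lekn) pochSr pochSl exprS natrB //.
have -> : a + k.+1%:R = a + 1 + k%:R by rewrite -natr1; ring.
by ring.
Qed.

Lemma sum_triangle n (F : nat -> nat -> C) :
  \sum_(c < n.+1) \sum_(a < c.+1) F a c =
  \sum_(a < n.+1) \sum_(k < (n - a).+1) F a (a + k)%N.
Proof.
elim: n => [|n IH]; first by rewrite !big_ord1.
rewrite big_ord_recr /= IH [X in _ + X = _]big_ord_recr /=.
rewrite [in RHS]big_ord_recr /= subnn big_ord1.
rewrite addn0 addrA -big_split; congr (_ + _); apply: eq_bigr => a _ /=.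
have lean : (a <= n)%N by rewrite -ltnS.
by rewrite (subSn lean) [in RHS]big_ord_recr /= -(subSn lean) subnKC // ltnW.
Qed.

(* Expanding (T - Q)_b by [poch_sub] and exchanging the sums leaves an inner sum
   that [poch_add] evaluates. *)
Lemma poch_sum_transform P Q T f N :
  \sum_(b < N.+1)
    (poch (T - Q) b / (b`!)%:R * poch P b)
    * (poch f (N - b) / ((N - b)`!)%:R * poch (T + b%:R) (N - b)) =
  \sum_(c < N.+1)
    ((-1) ^+ c * poch P c * poch Q c / (c`!)%:R)
    * (poch (P + f + c%:R) (N - c) * poch (T + c%:R) (N - c) / ((N - c)`!)%:R).
Proof.
pose F (c b : nat) : C := ((-1) ^+ c * poch Q c / (c`!)%:R)
  * (poch (T + c%:R) (b - c) / ((b - c)`!)%:R) * poch P b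
  * (poch f (N - b) / ((N - b)`!)%:R * poch (T + b%:R) (N - b)).
transitivity (\sum_(b < N.+1) \sum_(c < b.+1) F c b).
  apply: eq_bigr => b _; rewrite poch_sub !mulr_suml; apply: eq_bigr => c _.
  have lecb : (c <= b)%N by rewrite -ltnS.
  by rewrite natr_bin // /F; field; rewrite !natr_fact_neq0.
rewrite sum_triangle; apply: eq_bigr => c _.
have lecN : (c <= N)%N by rewrite -ltnS.
have -> : P + f + c%:R = P + c%:R + f by ring.
rewrite (poch_add (P + c%:R)) !mulr_suml mulr_sumr; apply: eq_bigr => k _.
have lekN : (k <= N - c)%N by rewrite -ltnS.
rewrite /F addKn subnDA natr_bin // !poch_cat natrD addrA.
rewrite -[in poch (T + c%:R) (N - c)](subnKC lekN) poch_cat.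
by field; rewrite !natr_fact_neq0.
Qed.

Lemma poch_oppn n k : (k <= n)%N ->
  poch (- n%:R) k = (-1) ^+ k * (n`!)%:R / ((n - k)`!)%:R :> C.
Proof.
elim: k => [|k IH] ltkn.
  by rewrite poch0 subn0 mul1r divff ?natr_fact_neq0.
rewrite pochSr IH 1?ltnW // exprS -(subnSK ltkn) factS natrM subnSK //.
rewrite natrB 1?ltnW //.
have nk : n%:R - k%:R != 0 :> C.
  by rewrite -natrB 1?ltnW // pnatr_eq0 -lt0n subn_gt0.
by field; rewrite natr_fact_neq0 nk.
Qed.

End PochhammerSums.

(** * The series A and B *)

Section Series.
Variable C : numFieldType.
Variables x y : nat -> C.
Implicit Types (q s i n : nat) (l : seq nat).

Let full_index_lt n l s : (s < size l)%N ->
  nth 0%N (full_index n l) s = nth 0%N l s.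
Proof. by move=> lts; rewrite nth_rcons lts. Qed.

Let full_index_last n l : nth 0%N (full_index n l) (size l) = (n - sumn l)%N.
Proof. by rewrite nth_rcons ltnn eqxx. Qed.

Let partial0 n l : partial n l 0 = 0%N.
Proof. by rewrite /partial take0. Qed.

Let partial_last n l : partial n l (size l) = sumn l.
Proof. by rewrite /partial /full_index -cats1 take_size_cat. Qed.

Let partialS n l s : (s <= size l)%N ->
  partial n l s.+1 = (partial n l s + nth 0%N (full_index n l) s)%N.
Proof.
by move=> les; rewrite /partial (take_nth 0%N) ?sumn_rcons // size_rcons ltnS.
Qed.

Let poch_ratio_partial n l s (c : C) : (s <= size l)%N ->
  poch_ratio c (partial n l s.+1) (partial n l s) =
  poch (c + (partial n l s)%:R) (nth 0%N (full_index n l) s).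
Proof. by move=> les; rewrite /poch_ratio partialS // addKn. Qed.

(** Steps are counted from 0: step [s] leads from g^(s+1) to g^(s+2). *)
Definition A_kernel s i k : C :=
  poch (y s.+2 - x s.+1) k / (k`!)%:R * poch (nu x y s.+1 + i%:R) k.

Lemma chain_A_kernel q n : chain A_kernel q n = norlund q.+1 n x y.
Proof. by elim: q n => //= q IH n; apply: eq_bigr => i _; rewrite IH mulrC. Qed.

Lemma A_seriesE q n : A_series q.+2 n x y = norlund q.+2 n x y.
Proof.
rewrite -chain_A_kernel; apply: chain_tuple_sum => [l|l sl leln].
  exact: A_term_eq0.
rewrite /= in sl *; have pL : partial n l q = sumn l by rewrite -sl partial_last.
have dL : nth 0%N (full_index n l) q = (n - sumn l)%N.
  by rewrite -sl full_index_last.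
rewrite /A_term /= !big_add1 /= big_nat_recr //= pL dL.
(* Here (-n)_|l| / n! = (-1)^|l| / (n - |l|)! supplies the factorial of the last entry, and its sign
   cancels that of [poch_refl_ratio]. *)
rewrite /poch_refl_ratio /A_kernel poch_oppn // big_split /=.
have -> : \prod_(0 <= s < q)
      poch_ratio (nu x y s.+1) (partial n l s.+1) (partial n l s) =
    \prod_(0 <= s < q)
      poch (nu x y s.+1 + (partial n l s)%:R) (nth 0%N (full_index n l) s).
  by apply: eq_big_nat => s /andP [_ lts]; rewrite poch_ratio_partial // sl ltnW.
rewrite /poch_ratio /idx /= !big_split /= -signr_odd.
set c := \prod_(_ <= _ < _) poch _ _; set d := \prod_(_ <= _ < _) poch _ _.
set e := \prod_(_ <= _ < _) _.
by case: (odd _); field; rewrite !natr_fact_neq0.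
Qed.

(* Steps |l_s| = i -> |l_(s+1)| = i + k; the last one, s = p - 2, has b = odd p. *)
Definition B_factor (b : bool) s i k : C :=
  if odd s == b
  then poch (psi x y s.+2 - y s.+1 + i%:R) k
       * poch (psi x y s.+2 - y s.+2 + i%:R) k
  else poch (psi x y s.+1 - x s.+1 + i%:R) k
       * poch (psi x y s.+1 - x s.+2 + i%:R) k.

(** The sign is what remains of (-1)^|l|, coming from (-n)_|l|, after multiplication by the explicit
    sign of the series. *)
Definition B_kernel (b : bool) s i k : C :=
  (-1) ^+ (if odd s == b then 0%N else k) * B_factor b s i k / (k`!)%:R.

(** For fixed outer indices a and n, the sum over the middle index of two recursion steps is a
    terminating 3F2, which [poch_sum_transform] rewrites with a new middle index. *)
Lemma norlund_two_steps r n : norlund r.+3 n x y =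
  \sum_(c < n.+1)
    (\sum_(a < c.+1) norlund r.+1 a x y * B_kernel (~~ odd r) r a (c - a))
    * B_kernel (~~ odd r) r.+1 c (n - c).
Proof.
pose g := fun m => norlund r.+1 m x y.
pose F a b : C := g a * (
  (poch (y r.+2 - x r.+1) (b - a) / ((b - a)`!)%:R
   * poch (psi x y r.+1 - x r.+1 + a%:R) (b - a))
  * (poch (y r.+3 - x r.+2) (n - b) / ((n - b)`!)%:R
     * poch (psi x y r.+2 - x r.+2 + b%:R) (n - b))).
transitivity (\sum_(b < n.+1) \sum_(a < b.+1) F a b).
  rewrite norlundSS; apply: eq_bigr => b _.
  rewrite norlundSS /norlund_step !mulr_sumr; apply: eq_bigr => a _.
  by rewrite /F /g; ring.
pose G a c : C :=
  g a * B_kernel (~~ odd r) r a (c - a) * B_kernel (~~ odd r) r.+1 c (n - c).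
transitivity (\sum_(c < n.+1) \sum_(a < c.+1) G a c); last first.
  by apply: eq_bigr => c _; rewrite mulr_suml.
rewrite !sum_triangle; apply: eq_bigr => a _.
have lean : (a <= n)%N by rewrite -ltnS.
(* These make P = nu_(r+1) + a, T + b = nu_(r+2) + a + b and T - Q = y_(r+2) - x_(r+1), as the two
   recursion steps require. *)
pose P := psi x y r.+1 - x r.+1 + a%:R; pose Q := psi x y r.+1 - x r.+2 + a%:R.
pose T := psi x y r.+3 - y r.+3 + a%:R; pose f := y r.+3 - x r.+2.
have := poch_sum_transform P Q T f (n - a) => /(congr1 ( *%R (g a))).
rewrite !mulr_sumr => e.
transitivity (\sum_(b < (n - a).+1) g a *
    (poch (T - Q) b / (b`!)%:R * poch P b *
     (poch f (n - a - b) / ((n - a - b)`!)%:R * poch (T + b%:R) (n - a - b)))).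
  apply: eq_bigr => b _; rewrite /F addKn subnDA.
  have -> : T - Q = y r.+2 - x r.+1 by rewrite /T /Q !psiS; ring.
  have -> : T + b%:R = psi x y r.+2 - x r.+2 + (a + b)%:R.
    by rewrite /T !psiS natrD; ring.
  by [].
rewrite e; apply: eq_bigr => c _.
rewrite /G addKn subnDA /B_kernel /B_factor /= eqxx.
have -> : (odd r == ~~ odd r) = false by case: odd.
have -> : psi x y r.+3 - y r.+2 + (a + c)%:R = P + f + c%:R.
  by rewrite /P /f !psiS natrD; ring.
have -> : psi x y r.+3 - y r.+3 + (a + c)%:R = T + c%:R.
  by rewrite /T natrD; ring.
by rewrite -/P -/Q expr0 /=; ring.
Qed.

(** The recursion jumps from p to p + 2 and preserves the parity flag, so two consecutive levels are
    carried together, starting from p = 1 and p = 2. *)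
Lemma chain_B_kernel r n : chain (B_kernel (~~ odd r)) r n = norlund r.+1 n x y.
Proof.
suff : (forall n, chain (B_kernel (~~ odd r)) r n = norlund r.+1 n x y) /\
   (forall n, chain (B_kernel (~~ odd r.+1)) r.+1 n = norlund r.+2 n x y) by case.
elim: r {n} => [|r [IH1 IH2]].
  split=> [//|n]; apply: eq_bigr => m _; rewrite [RHS]mulrC.
  case: m => [[|m] ltm] /=.
    rewrite !mul1r subn0 /B_kernel /B_factor /= mul1r !addr0 /nu /psi !big_nat1.
    rewrite big_nat_recr //= big_nat1.
    have -> : y 1%N + y 2 - x 1%N - y 1%N = y 2 - x 1%N by ring.
    have -> : y 1%N + y 2 - x 1%N - y 2 = y 1%N - x 1%N by ring.
    by ring.
  by rewrite !mul0r.
split=> // n; rewrite norlund_two_steps; apply: eq_bigr => c _ /=.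
rewrite !negbK; congr (_ * _); apply: eq_bigr => a _; congr (_ * _).
exact: IH1.
Qed.

(** Each even m in the series B collects the factors of two consecutive steps; this separates
    them. *)
Lemma prod_pairs (F : nat -> C) k :
  \prod_(0 <= s < k.*2.+1 | ~~ odd s) (F s * F s.+1) =
  \prod_(0 <= s < k.+1.*2) F s.
Proof.
elim: k => [|k IH].
  by rewrite big_mkcond big_nat1 /= big_nat_recr //= big_nat1.
rewrite [in LHS]doubleS big_mkcond; do 2 rewrite big_nat_recr //=.
rewrite -big_mkcond IH /= odd_double /= mulr1.
by rewrite [in RHS]doubleS; do 2 rewrite [in RHS]big_nat_recr //=; rewrite mulrA.
Qed.

Let B_prod n l : C := \prod_(0 <= s < (size l).+1)
  B_factor (odd (size l)) s (partial n l s) (nth 0%N (full_index n l) s).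

Let B_odd_prod n l : odd (size l) ->
  \prod_(2 <= m < (size l).+2 | ~~ odd m)
      (poch_ratio (psi x y m.-1 - x m.-1) (partial n l m.-1) (partial n l m.-2)
       * poch_ratio (psi x y m.-1 - x m) (partial n l m.-1) (partial n l m.-2)
       * poch_ratio (psi x y m.+1 - y m) (partial n l m) (partial n l m.-1)
       * poch_ratio (psi x y m.+1 - y m.+1) (partial n l m) (partial n l m.-1))
  = B_prod n l.
Proof.
move=> oq; rewrite /B_prod oq.
have eq : size l = (size l)./2.*2.+1.
  by rewrite -[LHS]odd_double_half oq.
rewrite {2}eq -doubleS -prod_pairs -eq !big_add1 /=.
rewrite big_nat_cond [RHS]big_nat_cond.
apply: eq_big => s; first by rewrite /= !negbK.
rewrite /= !negbK => /andP [lts evs].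
rewrite !poch_ratio_partial ?(ltnW lts) // /B_factor /= (negbTE evs) /=.
by rewrite !mulrA.
Qed.

(** For even p the two factors in front of the product form step 0, and the block of m carries steps
    m - 1 and m. *)
Let B_even_prod n l : ~~ odd (size l) -> (0 < size l)%N ->
  poch (psi x y 2 - y 2%N) (nth 0%N (full_index n l) 0)
  * poch (psi x y 2 - y 1%N) (nth 0%N (full_index n l) 0)
  * \prod_(2 <= m < (size l).+1 | ~~ odd m)
      (poch_ratio (psi x y m - x m) (partial n l m) (partial n l m.-1)
       * poch_ratio (psi x y m - x m.+1) (partial n l m) (partial n l m.-1)
       * poch_ratio (psi x y m.+2 - y m.+1) (partial n l m.+1) (partial n l m)
       * poch_ratio (psi x y m.+2 - y m.+2) (partial n l m.+1) (partial n l m))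
  = B_prod n l.
Proof.
move=> eq lq; rewrite /B_prod (negbTE eq).
have e : size l = ((size l)./2.-1).+1.*2.
  rewrite prednK ?half_gt0; first by rewrite -[LHS]odd_double_half (negbTE eq).
  by case: (size l) eq lq => [|[|k]].
rewrite big_nat_recl // {2}e -prod_pairs.
congr (_ * _); first by rewrite /B_factor /= partial0 !addr0 mulrC.
have e2 : (size l).-1 = (size l)./2.-1.*2.+1 by rewrite {1}e doubleS.
rewrite !big_add1 /= -e2.
rewrite big_nat_cond [RHS]big_nat_cond.
apply: eq_big => s; first by rewrite /= !negbK.
rewrite /= !negbK => /andP [lts evs].
have lts1 : (s.+2 <= size l)%N. by rewrite -ltn_predRL.
rewrite !poch_ratio_partial ?(ltnW lts1) // /B_factor /= (negbTE evs) /=.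
by rewrite !mulrA.
Qed.

(** The sign exponent stops at l_(p-3); letting it run to l_(p-2) adds nothing, because that index
    has the wrong parity. *)
Let sum_parity (d : nat -> nat) q :
  (\sum_(1 <= i < q.+1 | ~~ odd i == odd q.+1) d i.-1 =
   \sum_(0 <= s < q.+1 | odd s == odd q.+1) d s)%N.
Proof.
rewrite big_add1 big_mkcond [RHS]big_mkcond [RHS]big_nat_recr //=.
have -> : (odd q == ~~ odd q) = false by case: odd.
by rewrite addn0; apply: eq_bigr => s _; rewrite negbK.
Qed.

Let B_term_parity n l : (0 < size l)%N ->
  B_term (size l).+2 n x y l =
  poch (- n%:R) (sumn l)
  * (-1) ^+ (\sum_(0 <= s < size l | odd s == odd (size l))
               nth 0%N (full_index n l) s)%N
  / ((\prod_(0 <= s < size l) (nth 0%N (full_index n l) s)`!)%N%:R * (n`!)%:R)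
  * B_prod n l.
Proof.
move=> lq; have := sum_parity (nth 0%N (full_index n l)) (size l).-1.
rewrite prednK // => <-.
have eP : (\prod_(1 <= s < (size l).+1) (nth 0 (full_index n l) s.-1)`! =
    \prod_(0 <= s < size l) (nth 0 (full_index n l) s)`!)%N by rewrite big_add1.
rewrite /B_term /B_odd_term /B_even_term /idx /= negbK eP.
case: (boolP (odd (size l))) => oq.
  by rewrite B_odd_prod // (eq_bigl _ _ (fun i => eqb_id (~~ odd i))).
have -> : (\sum_(1 <= i < size l | ~~ odd i == false) nth 0 (full_index n l) i.-1 =
    \sum_(1 <= i < size l | odd i) nth 0 (full_index n l) i.-1)%N.
  by apply: eq_bigl => i; rewrite eqbF_neg negbK.
by rewrite -B_even_prod // !mulrA.
Qed.

Lemma B_termE n l : (0 < size l)%N -> (sumn l <= n)%N ->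
  B_term (size l).+2 n x y l =
  \prod_(0 <= s < (size l).+1)
    B_kernel (odd (size l)) s (partial n l s) (nth 0%N (full_index n l) s).
Proof.
move=> lq leln; rewrite B_term_parity //; set d := nth 0%N (full_index n l).
set q := size l; rewrite poch_oppn // /B_kernel !big_split /= -/(B_prod n l).
rewrite -expr_sum prodfV big_nat_recr //= eqxx addn0.
have -> : \prod_(0 <= s < q.+1) (d s)`!%:R =
    (\prod_(0 <= s < q) (d s)`!)%N%:R * ((n - sumn l)`!)%:R :> C.
  by rewrite big_nat_recr //= natr_prod /d /q full_index_last.
(* Splitting |l| by parity of the step: the first part is the explicit sign exponent, so it occurs
   twice and cancels. *)
have eL : sumn l = (\sum_(0 <= s < q | odd s == odd q) d s
    + \sum_(0 <= s < q) if odd s == odd q then 0 else d s)%N.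
  rewrite [X in (X + _)%N]big_mkcond -big_split /= sumnE (big_nth 0%N).
  apply: eq_big_nat => s /andP [_ lts]; rewrite /d full_index_lt //.
  by case: eqP; rewrite ?addn0.
rewrite [X in (-1) ^+ X * _ * _]eL exprD.
set a := (\sum_(_ <= _ < _ | _) _)%N; set b := (\sum_(_ <= _ < _) _)%N.
set P := (\prod_(_ <= _ < _) _)%N%:R.
have P0 : P != 0 by rewrite pnatr_eq0 -lt0n prodn_gt0 // => s; apply: fact_gt0.
by rewrite -(signr_odd _ a); case: (odd a); field; rewrite P0 !natr_fact_neq0.
Qed.

Lemma B_seriesE q n : (0 < q)%N -> B_series q.+2 n x y = norlund q.+2 n x y.
Proof.
move=> lq; rewrite -(chain_B_kernel q.+1) /= negbK.
apply: (chain_tuple_sum (K := B_kernel (odd q))) => [l|l sl leln].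
  exact: B_term_eq0.
by rewrite /= in sl *; rewrite -sl B_termE // sl.
Qed.

End Series.

(** * From coefficients of series to Bell and Bernoulli-Norlund polynomials *)

Theorem theorem2p13 (R : realType) (p n : nat) (hp : (1 <= p)%N)
    (x : p.-1.-tuple R[i]) (y : p.-tuple R[i]) (alpha : R[i]) :
  let nu_p : R[i] := \sum_(j < p) tnth y j - \sum_(j < p.-1) tnth x j in
  let qhat (m : nat) : R[i] :=
    (-1) ^+ m.+1 * ((m.-1)`!)%:R / (m.+1)%:R
    * (bernoulli m.+1 alpha + \sum_(j < p.-1) bernoulli m.+1 (tnth x j)
       - \sum_(j < p) bernoulli m.+1 (tnth y j)) in
  let rhs : R[i] :=
    \sum_(r < n.+1)
      poch (1 + alpha - nu_p - n%:R) (n - r) / ((r`!)%:R * ((n - r)`!)%:R)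
      * bell r qhat * gen_bernoulli (n%:R + nu_p - alpha) (n - r) (1 - alpha) in
  norlund p n (entry x) (entry y) = rhs
  /\ ((3 <= p)%N ->
      A_series p n (entry x) (entry y) = rhs
      /\ B_series p n (entry x) (entry y) = rhs).
Proof.
move=> nu_p qhat rhs.
suff main : norlund p n (entry x) (entry y) = rhs.
  split=> //; case: p hp x y nu_p qhat rhs main => [|[|[|p]]] // _ x y.
  move=> nu_p qhat rhs main _.
  by rewrite A_seriesE B_seriesE.
have sum_entry q (t : q.-tuple R[i]) (V : nmodType) (F : R[i] -> V) :
    \sum_(1 <= k < q.+1) F (entry t k) = \sum_(j < q) F (tnth t j).
  by rewrite big_add1 big_mkord; apply: eq_bigr => j _; rewrite (tnth_nth 0).
case: p hp x y @nu_p @qhat @rhs => // p _ x y nu_p qhat rhs.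
rewrite (norlundE _ _ alpha) !sum_entry.
have -> : psi (entry x) (entry y) p.+1 = nu_p.
  by rewrite /psi (sum_entry p.+1 y _ id) (sum_entry p x _ id).
(* The Cauchy product in [norlund_rhs] is compared term by term, with r the index in the exponential
   factor. *)
apply: eq_bigr => r _; rewrite /inv_fact_series gen_bernoulliE /bell.
have -> : 1 + alpha - (nu_p + n%:R) = 1 + alpha - nu_p - n%:R by ring.
have -> : nu_p + n%:R - alpha = n%:R + nu_p - alpha by ring.
set Q : fps R[i] := stirling alpha + _ - _.
(* Dividing by m! turns (m - 1)! / (m + 1) into 1 / (m (m + 1)), the Stirling coefficient. *)
have -> : (fun m => if m == 0%N then 0 else qhat m / (m`!)%:R) = Q.
  apply/funext => -[|m]; rewrite /Q fpsB fpsD !fps_sumE.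
    by rewrite !big1 // !addr0 subrr.
  have sum_stirling q (t : q.-tuple R[i]) :
      \sum_(j < q) stirling (tnth t j) m.+1 =
      (-1) ^+ m.+2 / (m.+1%:R * m.+2%:R) * \sum_(j < q) bernoulli m.+2 (tnth t j).
    by rewrite mulr_sumr.
  rewrite !sum_stirling /stirling /qhat /=.
  set bx := \sum_j _; set bY := \sum_j _; set ba := bernoulli _ _.
  rewrite factS natrM.
  by field; rewrite nat1r natr_fact_neq0 -natrD !pnatr_eq0.
set e := fps_exp Q r; set a := poch _ _; set b := bern_series _ _ _.
by field; rewrite !natr_fact_neq0.
Qed.
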